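(* Assume that for $t\in[0,T)$, $g(t)$ (also written $g_t$) is a family of Riemannian metrics on the manifold $M^n$ depending smoothly on $t$, and that for each $t\in[0,T)$ the Omori-Yau maximum principle at infinity applies to $g_t$. Let $u:M\times[0,T)\to\mathbb{R}$ be a smooth function such that $|u(x,t)|\le C(t)$, $|\nabla u|\le C(t)$ and $|u_t|_{C^\alpha}\le C(t)$ for each time $t\in(0,T)$, satisfying $$\left(\partial_t-H^{ij}\nabla^{g_t}_i\nabla^{g_t}_j\right)u=\langle X(x,u,\nabla^{g_t}u,t),\nabla^{g_t}u\rangle_{g_t}+F(u),$$ where $|X|\le C_1(t)$, $F$ is a locally Lipschitz function on $\mathbb{R}$, and $H_{ij}$ is a symmetric, positive definite matrix with $|H|\le C_0$. Set $u_{sup}(t)=\sup_{x\in M}u(x,t)$. Then: (1) $u_{sup}$ is locally Lipschitz and hence differentiable at almost every time $t\in[0,T)$. At every time $t$ of differentiability, $$\frac{d u_{sup}(t)}{dt}=\lim_{k\to\infty}\frac{\partial u(x_k,t)}{\partial t},$$ where $\{x_k\}\subset M$ is any sequence such that $\lim_{k\to\infty}u(x_k,t)=\sup_{x\in M}u(x,t)$. (2) If $\varphi:[0,T')\to\mathbb{R}$ is a maximal solution of the ODE $\varphi'(t)=F(\varphi(t))$, $\varphi(0)=u_{sup}(0)$, then $u(x,t)\le\varphi(t)$ for $(x,t)\in M\times[0,\min\{T,T'\})$.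
   Context: ''The Omori-Yau maximum principle at infinity applies to $g$'' means: for every bounded above $f\in C^2(M)$ there is a sequence $\{x_k\}\subset M$ with $f(x_k)>\sup_Mf-\frac1k$, $|\nabla f|(x_k)<\frac1k$ and $\nabla\nabla f(x_k)<\frac1k\,g$ as symmetric bilinear forms. $\nabla^{g_t}$ is the Levi-Civita connection of $g_t$, and norms at time $t$ are taken with respect to $g_t$. $X$ is a vector field on $M$ depending on $(x,u,\nabla^{g_t}u,t)$. $C(t)$ and $C_1(t)$ are finite bounds depending only on $t$, $C_0$ is a constant, and $|u_t|_{C^\alpha}$ is the $C^\alpha$ Hölder norm of $u_t=\partial u/\partial t$.
   Formalization: The bound |u_t|_{C^α} ≤ C(t) is taken as a Hölder norm in space and time on M×[0,t] (metric g_t + dt²) for each t in (0,T); with a purely spatial norm at each fixed time, the derivative formula in (1) is false. *)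

(* Defs.v *)
From HB Require Import structures.
From mathcomp Require Import all_boot all_order all_algebra.
From mathcomp Require Import all_classical all_reals all_analysis.

Set Implicit Arguments.
Unset Strict Implicit.
Unset Printing Implicit Defensive.

Import Order.TTheory GRing.Theory Num.Theory.
Import numFieldNormedType.Exports.

Local Open Scope classical_set_scope.
Local Open Scope ring_scope.

Section Calculus.
Context {R : realType}.

(* C^k on an open set U of a finite-dimensional space E: all iterated
   directional derivatives up to order k exist on U and are continuous there. *)
Fixpoint Ck {E W : normedModType R} (k : nat) (U : set E) (f : E -> W) : Prop :=
  (forall p, U p -> {for p, continuous f}) /\
  match k with
  | 0 => True
  | k'.+1 => forall v : E,
      (forall p, U p -> derivable f p v) /\ Ck k' U (fun p => 'D_v f p)
  end.

(* Smoothness on a set A that need not be open (such as U x [0, T)): f has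
   a smooth extension to a neighbourhood of each point of A. *)
Definition smooth_on {E W : normedModType R} (A : set E) (f : E -> W) : Prop :=
  forall p, A p -> exists (U : set E) (h : E -> W),
    [/\ open_nbhs p U, (forall k, Ck k U h) &
        forall q, U q -> A q -> h q = f q].

(* [0, T) with T <= +oo. *)
Definition times (T : \bar R) : set R := [set t | 0 <= t /\ (t%:E < T)%E].

Definition diff_quotient (f : R -> R) (t s : R) : R := (s - t)^-1 * (f s - f t).

(* Derivative of f at t relative to A: one-sided at an endpoint of A. *)
Definition deriv_in (A : set R) (f : R -> R) (t : R) : R :=
  lim (diff_quotient f t s @[s --> within A t^']).

Definition has_deriv_in (A : set R) (f : R -> R) (t l : R) : Prop :=
  diff_quotient f t s @[s --> within A t^'] --> l.

Definition ode_solution (F : R -> R) (y0 : R) (T : \bar R) (phi : R -> R) : Prop :=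
  [/\ (0 < T)%E, phi 0 = y0 &
      forall t, times T t -> has_deriv_in (times T) phi t (F (phi t))].

Definition maximal_ode_solution
    (F : R -> R) (y0 : R) (T : \bar R) (phi : R -> R) : Prop :=
  ode_solution F y0 T phi /\
  ~ exists (T1 : \bar R) (psi : R -> R),
      [/\ (T < T1)%E, ode_solution F y0 T1 psi &
          forall t, times T t -> psi t = phi t].

End Calculus.

(* A smooth n-manifold without boundary, given by a smooth atlas.  mchart i and
   minv i are total functions, meaningful on mdom i and on its image only. *)
Record manifold (R : realType) (n : nat) := Manifold {
  mspace :> topologicalType;
  mhausdorff : hausdorff_space mspace;
  mcountable : @second_countable mspace;
  mindex : Type;
  mdom : mindex -> set mspace;
  mchart : mindex -> mspace -> 'rV[R]_n;
  minv : mindex -> 'rV[R]_n -> mspace;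
  mdom_open : forall i, open (mdom i);
  mcover : forall x, exists i, mdom i x;
  mimage_open : forall i, open (mchart i @` mdom i);
  mchartK : forall i x, mdom i x -> minv i (mchart i x) = x;
  mchart_continuous : forall i x, mdom i x -> {for x, continuous (mchart i)};
  minv_continuous : forall i y, (mchart i @` mdom i) y ->
    {for y, continuous (minv i)};
  mtransition_smooth : forall i j k,
    Ck k (mchart i @` (mdom i `&` mdom j)) (mchart j \o minv i)
}.

Section Geometry.
Context {R : realType} {n : nat} (M : manifold R n).
Local Notation I := (mindex M).

Definition form (A : 'M[R]_n) (v w : 'rV[R]_n) : R := (v *m A *m w^T) 0 0.

Definition symmetric_posdef (A : 'M[R]_n) : Prop :=
  A^T = A /\ forall v, v != 0 -> 0 < form A v v.

Definition transition_diff (i j : I) (x : M) (v : 'rV[R]_n) : 'rV[R]_n :=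
  'D_v (mchart j \o minv (m := M) i) (mchart i x).

(* A tangent vector at x is the family of its components in the charts around
   x, related by the differentials of the transition maps; the components in
   the charts that do not contain x are set to 0, so that the family is
   uniquely determined by the vector. *)
Definition components := I -> 'rV[R]_n.

Definition tangent (x : M) (v : components) : Prop :=
  (forall i, ~ mdom i x -> v i = 0) /\
  (forall i j, mdom i x -> mdom j x -> v j = transition_diff i j x (v i)).

(* The (0,2)-tensor h i x has matrix (h_ab) in the chart i, for x in mdom i. *)
Definition components2 := I -> M -> 'M[R]_n.

Definition tensor2 (h : components2) : Prop :=
  forall x i j, mdom i x -> mdom j x -> forall v w,
    form (h i x) v w =
    form (h j x) (transition_diff i j x v) (transition_diff i j x w).

Definition posdef_tensor2 (h : components2) : Prop :=
  tensor2 h /\ forall x i, mdom i x -> symmetric_posdef (h i x).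

Definition chart_image (i : I) : set 'rV[R]_n := mchart i @` mdom i.

Definition C2 (f : M -> R) : Prop :=
  forall i, Ck 2 (chart_image i) (f \o minv i).

Definition smooth_spacetime (T : \bar R) (f : M -> R -> R) : Prop :=
  forall i, smooth_on (chart_image i `*` times T)
    (fun p : 'rV[R]_n * R => f (minv i p.1) p.2).

Definition smooth_metric_family (T : \bar R) (g : R -> components2) : Prop :=
  (forall t, times T t -> posdef_tensor2 (g t)) /\
  (forall i a b, smooth_on (chart_image i `*` times T)
    (fun p : 'rV[R]_n * R => g p.2 i (minv i p.1) a b)).

Definition partial (a : 'I_n) (f : 'rV[R]_n -> R) (y : 'rV[R]_n) : R :=
  'D_(delta_mx 0 a) f y.

(* Christoffel symbol Gamma^c_ab of the Levi-Civita connection of g in the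
   chart i, at the point with coordinates y. *)
Definition christoffel (g : components2) (i : I) (c a b : 'I_n)
    (y : 'rV[R]_n) : R :=
  let gi d e := fun z => g i (minv i z) d e in
  2^-1 * \sum_l invmx (g i (minv i y)) c l *
    (partial a (gi b l) y + partial b (gi a l) y - partial l (gi a b) y).

(* nabla_a nabla_b f = d_a d_b f - Gamma^c_ab d_c f in the chart i. *)
Definition hessian (g : components2) (i : I) (f : M -> R) (x : M) : 'M[R]_n :=
  let y := mchart i x in let fi := f \o minv i in
  \matrix_(a, b) (partial a (partial b fi) y
                  - \sum_c christoffel g i c a b y * partial c fi y).

Definition grad (g : components2) (f : M -> R) (x : M) : components :=
  fun i => if `[< mdom i x >]
    then (\row_a partial a (f \o minv i) (mchart i x)) *m invmx (g i x)
    else 0.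

(* Scalars built from tensors do not depend on the chart in which they are
   computed; the definitions below use an arbitrary chart around the point. *)
Definition chart_at (x : M) : I := projT1 (cid (mcover x)).

Definition inner (g : components2) (x : M) (v w : components) : R :=
  let i := chart_at x in form (g i x) (v i) (w i).

Definition vnorm (g : components2) (x : M) (v : components) : R :=
  Num.sqrt (inner g x v v).

(* h^ab = g^ac g^bd h_cd, for symmetric h. *)
Definition raise (g h : components2) (i : I) (x : M) : 'M[R]_n :=
  invmx (g i x) *m h i x *m invmx (g i x).

(* |h|^2 = g^ac g^bd h_ab h_cd. *)
Definition norm2 (g h : components2) (x : M) : R :=
  let i := chart_at x in
  Num.sqrt (\sum_a \sum_b raise g h i x a b * h i x a b).

(* h^ab nabla_a nabla_b f *)
Definition hess_contract (g h : components2) (f : M -> R) (x : M) : R :=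
  let i := chart_at x in
  \sum_a \sum_b raise g h i x a b * hessian g i f x a b.

Definition omori_yau (g : components2) : Prop :=
  forall f : M -> R, C2 f -> (exists B, forall x, f x <= B) ->
  exists x_ : nat -> M, forall k, let i := chart_at (x_ k) in
    [/\ sup (range f) - k.+1%:R^-1 < f (x_ k),
        vnorm g (x_ k) (grad g f (x_ k)) < k.+1%:R^-1 &
        forall v, v != 0 ->
          form (hessian g i f (x_ k)) v v <
          k.+1%:R^-1 * form (g i (x_ k)) v v].

Definition segment_length (g : components2) (i : I) (c : R -> 'rV[R]_n) : \bar R :=
  (\int[lebesgue_measure]_(s in `[0%R, 1%R])
     (Num.sqrt (form (g i (minv i (c s))) (derive1 c s) (derive1 c s)))%:E)%E.

(* L is the length of a piecewise C^1 curve from x to y, cut into pieces that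
   each lie in one chart and are parametrized by [0, 1]. *)
Inductive curve_length (g : components2) : M -> M -> \bar R -> Prop :=
| curve_nil x : curve_length g x x 0%E
| curve_cons i (c : R -> 'rV[R]_n) y L :
    Ck 1 [set: R] c ->
    (forall s, 0 <= s <= 1 -> chart_image i (c s)) ->
    curve_length g (minv i (c 1)) y L ->
    curve_length g (minv i (c 0)) y (segment_length g i c + L)%E.

Definition dist (g : components2) (x y : M) : \bar R :=
  ereal_inf [set L | curve_length g x y L].

(* Distance on M x R of the product metric g + dt^2. *)
Definition spacetime_dist (g : components2) (p q : M * R) : \bar R :=
  poweR (dist g p.1 q.1 * dist g p.1 q.1 + ((p.2 - q.2) ^+ 2)%:E)%E (2^-1).

(* C^alpha norm of f on M x [0, t] for the distance of g + dt^2.  The Hoelder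
   condition is in space and time: one in space alone, at each fixed time,
   would not control f along the time direction uniformly over M. *)
Definition holder_norm (g : components2) (alpha t : R) (f : M -> R -> R) : \bar R :=
  let Q := [set p : M * R | 0 <= p.2 <= t] in
  (ereal_sup [set `|f p.1 p.2|%:E | p in Q] +
   ereal_sup [set `|f pq.1.1 pq.1.2 - f pq.2.1 pq.2.2|%:E
                  * inve (poweR (spacetime_dist g pq.1 pq.2) alpha)
             | pq in [set pq | [/\ Q pq.1, Q pq.2 & pq.1 <> pq.2]]])%E.

Definition time_deriv (T : \bar R) (u : M -> R -> R) (x : M) (t : R) : R :=
  deriv_in (times T) (u x) t.

Definition usup (u : M -> R -> R) (t : R) : R := sup (range (u ^~ t)).

End Geometry.

(* Main.v *)
(** Since [u] is Lipschitz in time and [u_t] is Hoelder in time, both uniformly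
   in space, [u x s >= u x t + u_t x t (s - t) - C |s - t|^(1 + alpha)].  If
   [x_k] maximizes [u (., t)] and [a] is a limit point of [u_t x_k t], then [a]
   is a subgradient of [usup] at [t] up to the error [C |s - t|^(1 + alpha)].
   Hence a choice of such slopes is nondecreasing up to a small error, [usup]
   is differentiable wherever the slope is continuous, and the slope has only
   countably many jumps.  If the [x_k] come from the Omori-Yau principle, the
   equation bounds [u_t x_k t] by [F (usup t) + o(1)], so that the left
   difference quotients of [usup] at [t] are at most [F (usup t) + o(1)], and
   [usup] stays below the solution of the ODE. *)
Require Import Defs.
From HB Require Import structures.
From mathcomp Require Import all_boot all_order all_algebra.
From mathcomp Require Import all_classical all_reals all_analysis.
From mathcomp Require Import ring lra.

Set Implicit Arguments.
Unset Strict Implicit.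
Unset Printing Implicit Defensive.

Import Order.TTheory GRing.Theory Num.Theory.
Import numFieldNormedType.Exports.

Local Open Scope classical_set_scope.
Local Open Scope ring_scope.

(* [all_algebra] has another [form]. *)
Local Notation form := Defs.form.

(** * Positive definite matrices *)

Section PosDef.
Context {R : realType}.

Lemma formDl n (A : 'M[R]_n) (u v w : 'rV[R]_n) :
  form A (u + v) w = form A u w + form A v w.
Proof. by rewrite /form !mulmxDl mxE. Qed.

Lemma formDr n (A : 'M[R]_n) (u v w : 'rV[R]_n) :
  form A w (u + v) = form A w u + form A w v.
Proof. by rewrite /form linearD mulmxDr mxE. Qed.

Lemma formZl n (A : 'M[R]_n) (a : R) (u w : 'rV[R]_n) :
  form A (a *: u) w = a * form A u w.
Proof. by rewrite /form -!scalemxAl mxE. Qed.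

Lemma formZr n (A : 'M[R]_n) (a : R) (u w : 'rV[R]_n) :
  form A w (a *: u) = a * form A w u.
Proof. by rewrite /form linearZ -scalemxAr mxE. Qed.

Lemma form0 n (A : 'M[R]_n) (w : 'rV[R]_n) : form A 0 w = 0.
Proof. by rewrite /form !mul0mx mxE. Qed.

Lemma formC n (A : 'M[R]_n) (u v : 'rV[R]_n) : A^T = A ->
  form A u v = form A v u.
Proof.
move=> sA; rewrite /form -[LHS]/((u *m A *m v^T) 0 0).
by rewrite -[in LHS](trmxK (u *m A *m v^T)) mxE !trmx_mul trmxK sA mulmxA.
Qed.

Lemma posdef_form_ge0 n (A : 'M[R]_n) (v : 'rV[R]_n) :
  symmetric_posdef A -> 0 <= form A v v.
Proof.
move=> [_ pA]; have [->|v0] := eqVneq v 0; first by rewrite form0.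
exact/ltW/pA.
Qed.

(** The form is nonnegative on every [s *: u - t *: v], and well-chosen [s] and [t] turn this into
    the bound on [form A u v]. *)
Lemma form_CauchySchwarz n (A : 'M[R]_n) (u v : 'rV[R]_n) :
  symmetric_posdef A ->
  form A u v <= Num.sqrt (form A u u) * Num.sqrt (form A v v).
Proof.
move=> pA.
have h (s t : R) : 0 <= s ^+ 2 * form A u u - 2 * s * t * form A u v + t ^+ 2 * form A v v.
  have := posdef_form_ge0 (s *: u - t *: v) pA.
  rewrite -scaleNr formDl !formDr !formZl !formZr (formC v u pA.1).
  by congr (_ <= _); ring.
set a := form A u u in h *; set b := form A v v in h *; set c := form A u v in h *.
have a0 : 0 <= a by exact: posdef_form_ge0.
have b0 : 0 <= b by exact: posdef_form_ge0.
rewrite -sqrtrM//; have [c0|c0] := leP c 0; first by rewrite (le_trans c0)// sqrtr_ge0.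
rewrite -(ger0_norm (ltW c0)) -sqrtr_sqr ler_sqrt ?mulr_ge0//.
have [b_gt|b_le] := ltP 0 b; last first.
  have b00 : b = 0 by apply/eqP; rewrite eq_le b_le b0.
  (* When [b = 0] this combination has value [- c ^+ 2], which excludes [0 < c]. *)
  have := h c ((1 + a) / 2); rewrite b00.
  have -> : c ^+ 2 * a - 2 * c * ((1 + a) / 2) * c + ((1 + a) / 2) ^+ 2 * 0 =
    - c ^+ 2 by field.
  by rewrite oppr_ge0 leNgt exprn_gt0.
(* Up to the factor [b], this combination is the discriminant [a * b - c ^+ 2]. *)
have := h b c.
have -> : b ^+ 2 * a - 2 * b * c * c + c ^+ 2 * b = b * (a * b - c ^+ 2) by ring.
by rewrite pmulr_rge0// subr_ge0.
Qed.

Lemma posdef_unitmx n (A : 'M[R]_n) : symmetric_posdef A -> A \in unitmx.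
Proof.
move=> [_ pA]; rewrite -row_free_unit; apply/row_freeP.
have : kermx A = 0.
  apply/eqP/rowV0P => v /sub_kermxP vA; apply/eqP; apply: contraT => /pA.
  by rewrite /form vA mul0mx mxE ltxx.
move=> /eqP; rewrite kermx_eq0 => /row_freeP//.
Qed.

Lemma posdef_congr n (A B : 'M[R]_n) : B^T = B -> B \in unitmx ->
  symmetric_posdef A -> symmetric_posdef (B *m A *m B).
Proof.
move=> sB uB [sA pA]; split; first by rewrite !trmx_mul sA sB mulmxA.
move=> v v0; suff -> : form (B *m A *m B) v v = form A (v *m B) (v *m B).
  apply: pA; apply: contra_neq v0 => vB.
  by rewrite -(mulmxK uB v) vB mul0mx.
by rewrite /form trmx_mul sB !mulmxA.
Qed.

Lemma posdef_inv n (A : 'M[R]_n) : symmetric_posdef A ->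
  symmetric_posdef (invmx A).
Proof.
move=> pA; have uA := posdef_unitmx pA.
have sI : (invmx A)^T = invmx A by rewrite trmx_inv pA.1.
have := posdef_congr sI _ pA; rewrite mulVmx// mul1mx; apply.
by rewrite unitmx_inv.
Qed.

(** Induction on the size: split off the first coordinate. The Schur complement [D'] of the corner
    entry is again positive definite, and its factor [W'] is completed to a block triangular factor
    of [A]. *)
Lemma cholesky n (A : 'M[R]_n) : symmetric_posdef A ->
  exists W : 'M[R]_n, A = W^T *m W.
Proof.
elim: n A => [|n IH] A pA; first by exists 0; rewrite mulmx0 [LHS]flatmx0.
pose A' : 'M[R]_(1 + n) := A; have pA' : symmetric_posdef A' by [].
pose a := ulsubmx A'; pose b := ursubmx A'; pose D := drsubmx A'.
have Adef : A' = block_mx a b b^T D.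
  by rewrite -[LHS]submxK; congr block_mx; rewrite /b trmx_ursub pA'.1.
have DT : D^T = D by rewrite /D trmx_drsub pA'.1.
have aE : a = (a 0 0)%:M by rewrite [LHS]mx11_scalar.
pose al : R := a 0 0; rewrite -/al in aE.
have formE (x : R) (v : 'rV[R]_n) : form A' (row_mx x%:M v) (row_mx x%:M v) =
    x ^+ 2 * al + 2 * x * (v *m b^T) 0 0 + form D v v.
  have -> : form A' (row_mx x%:M v) (row_mx x%:M v) =
      (x%:M *m a *m x%:M + v *m b^T *m x%:M +
        (x%:M *m (v *m b^T)^T + v *m D *m v^T)) 0 0.
    rewrite /form Adef mul_row_block tr_row_mx mul_row_col !mulmxDl.
    by rewrite tr_scalar_mx trmx_mul trmxK !mulmxA.
  rewrite aE !mul_scalar_mx !mul_mx_scalar /form.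
  move: (v *m b^T) (v *m D *m v^T) => w d; rewrite !mxE eqxx mulr1n; ring.
have a0 : 0 < al.
  have := pA'.2 (row_mx 1%:M 0); rewrite formE mul0mx form0 mxE mulr0 !addr0 expr1n mul1r.
  apply; apply/eqP => /(congr1 (fun M : 'M[R]_(1, 1 + n) => lsubmx M 0 0)).
  by rewrite row_mxKl !mxE eqxx => /eqP; rewrite oner_eq0.
have an0 : al != 0 by rewrite gt_eqF.
pose D' := D - al^-1 *: (b^T *m b).
have pD' : symmetric_posdef D'.
  split; first by rewrite /D' linearB/= DT linearZ/= trmx_mul trmxK.
  move=> v v0.
  (* This first coordinate minimizes the form of [A'] among the vectors with remaining part [v]; the
     minimum is the value of [D'] at [v]. *)
  have := pA'.2 (row_mx (- al^-1 * (v *m b^T) 0 0)%:M v).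
  rewrite formE.
  have -> : form D' v v = form D v v - al^-1 * ((v *m b^T) 0 0) ^+ 2.
    rewrite /form /D' mulmxBr mulmxBl -scalemxAr -scalemxAl !mulmxA.
    rewrite -(mulmxA (v *m b^T)) -[b *m v^T]trmxK trmx_mul trmxK.
    move: (v *m b^T) (v *m D *m v^T) => w d.
    by rewrite [w]mx11_scalar tr_scalar_mx -scalar_mxM !mxE eqxx.
  set w := (v *m b^T) 0 0.
  have -> : (- al^-1 * w) ^+ 2 * al + 2 * (- al^-1 * w) * w + form D v v = form D v v - al^-1 * w ^+ 2.
    by field.
  apply; apply: contra_neq v0 => /(congr1 rsubmx).
  by rewrite row_mxKr => ->; rewrite linear0.
have [W' W'E] := IH _ pD'.
pose W : 'M[R]_(1 + n) := block_mx (Num.sqrt al)%:M ((Num.sqrt al)^-1 *: b) 0 W'.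
suff WE : A' = W^T *m W by exists W.
have s0 : Num.sqrt al != 0 by rewrite sqrtr_eq0 -ltNge.
have ss : Num.sqrt al * Num.sqrt al = al by rewrite -expr2 sqr_sqrtr// ltW.
rewrite Adef /W tr_block_mx mulmx_block !trmx0 !mulmx0 !mul0mx !addr0.
have -> : ((Num.sqrt al)^-1 *: b)^T = (Num.sqrt al)^-1 *: b^T by rewrite linearZ.
rewrite tr_scalar_mx -scalar_mxM ss -aE mul_mx_scalar mul_scalar_mx.
rewrite !scalerA mulfV ?mulVf// !scale1r -W'E /D' -scalemxAl -scalemxAr scalerA.
by rewrite -invfM ss addrC subrK.
Qed.

Lemma sum_mxE n (A B : 'M[R]_n) :
  \sum_a \sum_b A a b * B a b = \tr (A *m B^T).
Proof.
by rewrite /mxtrace; apply: eq_bigr => i _; rewrite mxE; apply: eq_bigr => j _; rewrite mxE.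
Qed.

(** With [S = W^T *m W] the trace becomes the sum of the values of [N] on the rows of [W]. *)
Lemma mxtrace_posdef_ge0 n (S N : 'M[R]_n) :
  symmetric_posdef S -> (forall v, 0 <= form N v v) -> 0 <= \tr (S *m N^T).
Proof.
move=> /cholesky[W ->] pN; rewrite -mulmxA mxtrace_mulC -mulmxA.
rewrite /mxtrace sumr_ge0// => i _.
suff -> : (W *m (N^T *m W^T)) i i = form N (row i W) (row i W) by apply: pN.
rewrite -trmx_mul /form -row_mul !mxE; apply: eq_bigr => j _.
by rewrite !mxE mulrC.
Qed.

(* The inequality [2 tr (G^-1 h) <= |h|^2 + n] is the nonnegativity of
   [|h - g|^2]. *)
Lemma trace_le n (G h : 'M[R]_n) : symmetric_posdef G -> h^T = h ->
  2 * \tr (invmx G *m h) <= \tr (invmx G *m h *m invmx G *m h) + n%:R.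
Proof.
move=> pG sh; have uG := posdef_unitmx pG.
have [W WE] := cholesky (posdef_inv pG).
set k := h - G; have sk : k^T = k by rewrite /k linearB/= sh pG.1.
have : 0 <= \tr (invmx G *m k *m invmx G *m k).
  rewrite WE.
  have -> : \tr (W^T *m W *m k *m (W^T *m W) *m k) =
      \tr ((W *m k *m W^T) *m (W *m k *m W^T)^T).
    by rewrite !trmx_mul trmxK sk -[in RHS]mulmxA [RHS]mxtrace_mulC !mulmxA.
  rewrite -sum_mxE sumr_ge0// => i _; rewrite sumr_ge0// => j _.
  by rewrite -expr2 sqr_ge0.
rewrite /k !(mulmxBr, mulmxBl) mulVmx// mulmxKV// !mul1mx mulVmx// !linearB/= mxtrace1.
lra.
Qed.

(** Turns the Hessian bound of the Omori-Yau principle into a bound on the second order term of the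
    equation: [e *: G - B] is nonnegative, so its trace against [S] is, and [S *m G = invmx G *m h]
    has its trace bounded by [trace_le]. *)
Lemma contract_le n (G h B S : 'M[R]_n) (e : R) : 0 <= e ->
  symmetric_posdef G -> symmetric_posdef h ->
  (forall v, v != 0 -> form B v v < e * form G v v) ->
  S = invmx G *m h *m invmx G ->
  \sum_a \sum_b S a b * B a b <=
    e * ((\sum_a \sum_b S a b * h a b + n%:R) / 2).
Proof.
move=> e0 pG ph hB SE; have uG := posdef_unitmx pG.
have pS : symmetric_posdef S.
  by rewrite SE; apply: posdef_congr; rewrite ?unitmx_inv// (posdef_inv pG).1.
rewrite !sum_mxE.
have : 0 <= \tr (S *m (e *: G - B)^T).
  apply: mxtrace_posdef_ge0 => // v; have [->|v0] := eqVneq v 0.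
    by rewrite form0.
  have -> : form (e *: G - B) v v = e * form G v v - form B v v.
    by rewrite /form mulmxBr mulmxBl -scalemxAr -scalemxAl !mxE.
  by rewrite subr_ge0 ltW// hB.
rewrite linearB linearZ/= pG.1 mulmxBr linearB/= -scalemxAr linearZ/= subr_ge0.
move=> /le_trans; apply; rewrite ler_wpM2l//.
have -> : S *m G = invmx G *m h by rewrite SE mulmxKV.
by rewrite ler_pdivlMr// mulrC ph.1 SE trace_le// ph.1.
Qed.

End PosDef.

(** * Functions of class C^k and linear approximation *)

Section Calculus.
Context {R : realType}.

Lemma near_eq_continuous (E W : topologicalType) (f h : E -> W) p :
  (\near p, h p = f p) -> {for p, continuous h} -> {for p, continuous f}.
Proof.
move=> hf; rewrite /prop_for /continuous_at -(nbhs_singleton hf).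
by apply: cvg_trans; apply: near_eq_cvg.
Qed.

(** Smoothness of [u] is given by extensions that change from point to point. Continuity and
    directional derivatives depend only on germs, so such local data can be patched. *)
Lemma Ck_local (E W : normedModType R) k (A : set E) (f : E -> W) :
  (forall p, A p -> exists (U : set E) (h : E -> W),
    [/\ open_nbhs p U, Ck k U h & forall q, U q -> h q = f q]) -> Ck k A f.
Proof.
have near_hf p U (h g : E -> W) :
    open_nbhs p U -> (forall q, U q -> h q = g q) -> \near p, h p = g p.
  by move=> /open_nbhs_nbhs Up hf; apply: filterS Up.
elim: k A f => [|k IH] A f fP /=.
  split=> // p /fP[U [h [oU [hc _] hf]]].
  by apply: near_eq_continuous (hc p oU.2); apply: near_hf oU hf.
split=> [p /fP[U [h [oU hC hf]]]|v].
  by apply: near_eq_continuous (hC.1 p oU.2); apply: near_hf oU hf.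
split=> [p /fP[U [h [oU [_ /(_ v)[hd _]] hf]]]|].
  by apply: near_eq_derivable (hd p oU.2); apply: near_hf oU hf.
apply: IH => p /fP[U [h [oU [_ /(_ v)[_ hC]] hf]]].
exists U, (fun p => 'D_v h p); split=> // q Uq.
by apply: near_eq_derive; apply: near_hf hf; split=> //; case: oU.
Qed.

Lemma Ck_cst (E W : normedModType R) k (A : set E) (w : W) :
  Ck k A (fun _ : E => w).
Proof.
elim: k w => [|k IH] w /=; split=> //.
- by move=> p _; apply: cvg_cst.
- by move=> p _; apply: cvg_cst.
- move=> v; split=> [p _|]; first exact: derivable_cst.
  have -> : (fun p => 'D_v (fun=> w) p) = fun=> 0.
    by apply/funext => p; rewrite (derive_cst w).
  exact: IH.
Qed.

(** A difference quotient of a time slice along [v] is one of [h] along [(v, 0)], so existence and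
    value of the derivative transfer together. *)
Lemma derive_slice (E W : normedModType R) (h : E * R -> W) (t : R) (v y : E) :
  (fun l => l^-1 *: (((fun z => h (z, t)) \o shift y) (l *: v) - h (y, t))) =
  (fun l => l^-1 *: ((h \o shift (y, t)) (l *: (v, 0)) - h (y, t))).
Proof.
apply/funext => l /=; congr (_ *: (h _ - _)).
by rewrite /shift/= /GRing.scale/= /GRing.add/= /add_pair /scale_pair /= scaler0 add0r.
Qed.

Lemma Ck_sub (E W : normedModType R) k (A B : set E) (f : E -> W) :
  A `<=` B -> Ck k B f -> Ck k A f.
Proof.
move=> AB; elim: k f => [|k IH] f /= [fc fd].
  by split=> // p /AB; apply: fc.
split=> [p /AB|v]; first exact: fc.
by split=> [p /AB|]; [apply: (fd v).1|apply: IH (fd v).2].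
Qed.

Lemma continuous_pairl (E : topologicalType) (t : R) :
  continuous (fun z : E => (z, t)).
Proof.
move=> p.
exact: (@cvg_pair _ _ _ _ _ _ _ _ _ id (fun=> t)) cvg_id (cvg_cst t).
Qed.

Lemma Ck_slice (E W : normedModType R) k (U : set (E * R)) (h : E * R -> W) t :
  Ck k U h -> Ck k [set z | U (z, t)] (fun z => h (z, t)).
Proof.
elim: k h => [|k IH] h /= [hc hd].
all: have hc' p : U (p, t) -> {for p, continuous (fun z => h (z, t))}.
  1,3: move=> Up; apply: (@cvg_comp _ _ _ (fun z => (z, t)) h _ (nbhs (p, t))); last exact: (hc (p, t)).
  1,2: exact: continuous_pairl.
all: split=> //.
move=> v; split=> [p Up|].
  by rewrite /derivable derive_slice; apply: (hd (v, 0)).1.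
have -> : (fun p => 'D_v (fun z => h (z, t)) p) = fun z => 'D_(v, 0) h (z, t).
  by apply/funext => z; rewrite /derive derive_slice.
exact: (IH (fun q => 'D_(v, 0) h q) (hd (v, 0)).2).
Qed.

(** Differentiability without division or limits. It covers the derivative relative to [A],
    one-sided at an endpoint, and the usual one for [A = setT]. *)
Definition linear_approx (A : set R) (f : R -> R) (t l : R) :=
  forall e, 0 < e -> exists2 d, 0 < d & forall s, A s -> `|s - t| < d ->
    `|f s - f t - l * (s - t)| <= e * `|s - t|.

Lemma has_deriv_inP (A : set R) (f : R -> R) (t l : R) :
  has_deriv_in A f t l <-> linear_approx A f t l.
Proof.
have key s e : s != t -> (`|l - diff_quotient f t s| <= e) =
    (`|f s - f t - l * (s - t)| <= e * `|s - t|).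
  move=> st; have st0 : s - t != 0 by rewrite subr_eq0.
  have -> : f s - f t - l * (s - t) = - ((l - diff_quotient f t s) * (s - t)).
    by rewrite /diff_quotient; field.
  by rewrite normrN normrM ler_pM2r// normr_gt0.
split=> [/cvgrPdist_le fl e e0|fl].
  have [d /= d0 dP] := fl e e0.
  exists d => // s As std; have [->|st] := eqVneq s t.
    by rewrite !subrr mulr0 subr0 normr0 mulr0.
  by rewrite -key//; apply: (dP s _ st As); rewrite /ball_/= distrC.
apply/cvgrPdist_le => e e0; have [d d0 dP] := fl e e0.
exists d => //= s std st As; rewrite key//; apply: dP => //.
by rewrite distrC.
Qed.

Lemma is_deriveP (f : R -> R) (t l : R) :
  is_derive t 1 f l <-> linear_approx setT f t l.
Proof.
pose q (h : R) := h^-1 *: ((f \o shift t) (h *: 1) - f t).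
have key h e : h != 0 -> (`|l - q h| <= e) =
    (`|f (h + t) - f t - l * h| <= e * `|h|).
  move=> h0; rewrite /q /= [h%:A]mulr1 -[_ *: _]/(_ * _).
  have -> : f (h + t) - f t - l * h = - ((l - h^-1 * (f (h + t) - f t)) * h).
    by field.
  by rewrite normrN normrM ler_pM2r// normr_gt0.
suff qP : q h @[h --> 0^'] --> l <-> linear_approx setT f t l.
  rewrite -qP; split=> [[fd <-]//|fl].
  by apply: DeriveDef; [apply/cvg_ex; exists l|exact/cvg_lim].
split=> [/cvgrPdist_le fl e e0|fl].
  have [d /= d0 dP] := fl e e0.
  exists d => // s _ std; have [->|st] := eqVneq s t.
    by rewrite !subrr mulr0 subr0 normr0 mulr0.
  have st0 : s - t != 0 by rewrite subr_eq0.
  have := dP (s - t) _ st0; rewrite /ball_/= key// subrK; apply.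
  by rewrite /ball_/= sub0r normrN.
apply/cvgrPdist_le => e e0; have [d d0 dP] := fl e e0.
exists d => //= h /=; rewrite sub0r normrN => hd h0; rewrite key//.
by have := dP (h + t) I; rewrite addrK; apply.
Qed.

Lemma linear_approx_cvg (A : set R) (f : R -> R) (t l : R) :
  linear_approx A f t l -> f s @[s --> within A (nbhs t)] --> f t.
Proof.
move=> /(_ 1 ltr01)[d d0 dP]; apply/cvgrPdist_le => e e0.
pose m := `|l| + 1; have m0 : 0 < m by rewrite ltr_wpDl.
exists (Num.min d (e / m)); first by rewrite /= lt_min d0 divr_gt0.
move=> s /=; rewrite lt_min distrC => /andP[sd se] As.
rewrite distrC -(subrK (l * (s - t)) (f s - f t)).
rewrite (le_trans (ler_normD _ _))// normrM.
rewrite (le_trans (lerD (dP s As sd) (lexx _)))// -mulrDl addrC.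
by rewrite -ler_pdivlMl// mulrC ltW.
Qed.

(** Inside the interval the approximation relative to [A] is two-sided, because small balls stay in
    [A]; at the endpoints only continuity is required. *)
Lemma MVT_approx (A : set R) (f df : R -> R) (a b : R) : a < b ->
  (forall s, a <= s <= b -> A s) ->
  (forall s, a <= s <= b -> linear_approx A f s (df s)) ->
  exists2 c, a < c < b & f b - f a = df c * (b - a).
Proof.
move=> ab abA fd.
have [||c cab fE] := @MVT R f df a b ab.
- move=> s; rewrite in_itv/= => /andP[sa sb]; apply/is_deriveP => e e0.
  have [|d d0 dP] := fd s _ e e0; first by rewrite !ltW.
  exists (Num.min d (Num.min (s - a) (b - s))).
    by rewrite !lt_min d0 !subr_gt0 sa sb.
  move=> r _; rewrite !lt_min => /and3P[rd ra rb]; apply: dP => //.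
  apply: abA; move: ra rb; rewrite !ltr_norml; lra.
- apply/subspace_continuousP => s; rewrite /= in_itv/= => sab.
  apply: (linear_approx_cvg (l := df s)) => e e0.
  have [d d0 dP] := fd s sab e e0; exists d => // r rab.
  by apply: dP; apply: abA; move: rab; rewrite /= in_itv.
by exists c => //; move: cab; rewrite in_itv.
Qed.

End Calculus.

(** * Comparison with solutions of an ODE *)

Section Comparison.
Context {R : realType}.

Lemma within_continuous_itvP (f : R -> R) (a b : R) :
  {within `[a, b], continuous f} <->
  forall t, a <= t <= b -> forall e, 0 < e -> exists2 d, 0 < d &
    forall s, a <= s <= b -> `|s - t| < d -> `|f s - f t| < e.
Proof.
rewrite subspace_continuousP; split=> [fc t tab e e0|fc t].
  have /cvgrPdist_lt/(_ e e0)[d /= d0 dP] := fc t tab.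
  exists d => // s sab std; rewrite distrC; apply: dP => //.
  by rewrite /= distrC.
rewrite /= in_itv/= => /fc{}fc; apply/cvgrPdist_lt => e /fc[d d0 dP].
exists d => //= s /=; rewrite distrC => std; rewrite in_itv/= => sab.
by rewrite distrC dP.
Qed.

(* At a point [c] maximizing [f - phi - 2 L m (t - t0)], where [m] is the
   maximum of [f - phi], the left difference quotients of [f - phi] are at
   least [2 L m], although the differential inequality bounds them by about
   [L m]. *)
Lemma ode_comparison_local (F f phi : R -> R) (t0 t1 L : R) :
  t0 < t1 -> 0 < L -> L * (t1 - t0) <= 4^-1 ->
  {within `[t0, t1], continuous f} -> {within `[t0, t1], continuous phi} ->
  f t0 <= phi t0 ->
  (forall t, t0 < t <= t1 -> phi t < f t ->
    F (f t) - F (phi t) <= L * (f t - phi t)) ->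
  (forall t, t0 < t <= t1 -> forall e, 0 < e -> exists2 d, 0 < d &
    forall s, t0 <= s < t -> t - s < d -> f t - f s <= (F (f t) + e) * (t - s)) ->
  (forall t, t0 < t <= t1 -> forall e, 0 < e -> exists2 d, 0 < d &
    forall s, t0 <= s < t -> t - s < d ->
      (F (phi t) - e) * (t - s) <= phi t - phi s) ->
  f t1 <= phi t1.
Proof.
move=> t01 L0 L4 fc phic f0 FL hf hphi; rewrite leNgt; apply/negP => f1.
pose w t := f t - phi t.
have wc : {within `[t0, t1], continuous w}.
  by move=> t; apply: cvgB; [exact: fc|exact: phic].
have [c c01 wmax] := EVT_max (ltW t01) wc.
set m := w c in wmax.
have m0 : 0 < m.
  apply: lt_le_trans (wmax t1 _); first by rewrite /w subr_gt0.
  by rewrite in_itv/= lexx ltW.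
pose E t := w t - 2 * L * m * (t - t0).
have Ec : {within `[t0, t1], continuous E}.
  move=> t; apply: cvgB; first exact: wc.
  apply: cvgM; first exact: cvg_cst.
  by apply: cvgB; [apply: continuous_subspaceT => ?; exact: cvg_id|exact: cvg_cst].
have [b b01 Emax] := EVT_max (ltW t01) Ec.
move: c01 b01; rewrite !in_itv/= => /andP[c0 c1] /andP[b0 b1].
(* At [c] the penalty is at most [m / 2], so the maximum of [E] is positive. This forces [t0 < b],
   since [w t0 <= 0]. *)
have Eb : 0 < E b.
  apply: lt_le_trans (Emax c _); last by rewrite in_itv/= c0 c1.
  have : L * (c - t0) * m <= 4^-1 * m.
    by rewrite ler_pM2r// (le_trans _ L4)// ler_pM2l// lerD2r.
  rewrite /E -/m; lra.
have bt0 : t0 < b.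
  rewrite lt_neqAle b0 andbT; apply/eqP => bE; move: Eb.
  by rewrite /E -bE subrr mulr0 subr0 /w subr_gt0 ltNge f0.
have Lm : 0 < L * m by rewrite mulr_gt0.
have wb : 0 < w b.
  have : 0 <= L * m * (b - t0) by rewrite mulr_ge0 ?subr_ge0 // ltW.
  by move: Eb; rewrite /E; lra.
have wbm : w b <= m by apply: wmax; rewrite in_itv/= b0 b1.
(* The two one-sided estimates cost [2 * e = L * m / 2] in all. Together with [L * w b <= L * m]
   this gives slope at most [3 / 2 * L * m], below the required [2 * L * m]. *)
have e0 : 0 < L * m / 4 by rewrite divr_gt0.
have tb : t0 < b <= t1 by rewrite bt0 b1.
have [d1 d10 hd1] := hf b tb _ e0.
have [d2 d20 hd2] := hphi b tb _ e0.
have [s [s0 sb sd1 sd2]] : exists s, [/\ t0 <= s, s < b, b - s < d1 & b - s < d2].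
  pose r := Num.min (b - t0) (Num.min d1 d2) / 2.
  have r0 : 0 < r by rewrite divr_gt0// !lt_min subr_gt0 bt0 d10 d20.
  have : r * 2 <= Num.min (b - t0) (Num.min d1 d2) by rewrite /r divfK.
  rewrite !le_min => /and3P[r1 r2 r3].
  by exists (b - r); split; lra.
have sI : t0 <= s < b by rewrite s0.
have := hd1 s sI sd1; have := hd2 s sI sd2.
have : E s <= E b by apply: Emax; rewrite in_itv/= s0 (le_trans (ltW sb)).
rewrite /E /w => h1 h2 h3.
have := FL b tb; rewrite -subr_gt0 => /(_ wb) h4.
have : L * w b <= L * m by rewrite ler_pM2l.
rewrite /w => h5.
have bs : 0 < b - s by rewrite subr_gt0.
have : 2 * (L * m) * (b - s) <= (F (f b) - F (phi b) + L * m / 2) * (b - s) by lra.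
by rewrite ler_pM2r//; lra.
Qed.

(** Let [t0] be the last time with [f <= phi]. By continuity [f] and [phi] agree there, so just
    after [t0] both take values where one Lipschitz constant serves, and the local comparison
    contradicts the choice of [t0]. *)
Lemma ode_comparison (F f phi : R -> R) (t1 : R) :
  0 <= t1 ->
  (forall y, exists2 L, 0 < L & exists2 r, 0 < r & forall y1 y2,
    `|y1 - y| < r -> `|y2 - y| < r -> `|F y1 - F y2| <= L * `|y1 - y2|) ->
  {within `[0, t1], continuous f} -> {within `[0, t1], continuous phi} ->
  f 0 <= phi 0 ->
  (forall t, 0 < t <= t1 -> forall e, 0 < e -> exists2 d, 0 < d &
    forall s, 0 <= s < t -> t - s < d -> f t - f s <= (F (f t) + e) * (t - s)) ->
  (forall t, 0 < t <= t1 -> forall e, 0 < e -> exists2 d, 0 < d &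
    forall s, 0 <= s < t -> t - s < d ->
      (F (phi t) - e) * (t - s) <= phi t - phi s) ->
  f t1 <= phi t1.
Proof.
move=> t1_ge0 FL /within_continuous_itvP fc /within_continuous_itvP phic f0 hf hphi.
rewrite leNgt; apply/negP => f1.
pose S := [set t | 0 <= t <= t1 /\ f t <= phi t].
have S0 : S 0 by split=> //; rewrite lexx.
have Sub : has_ubound S by exists t1 => t [/andP[]].
have supS : has_sup S by split=> //; exists 0.
pose t0 := sup S.
have t0_ge0 : 0 <= t0 by apply: ub_le_sup.
have t0_le : t0 <= t1 by apply: ge_sup => [|t [/andP[]]]//; exists 0.
have t0I : 0 <= t0 <= t1 by rewrite t0_ge0.
have after t : t0 < t -> t <= t1 -> phi t < f t.
  move=> t0t tt1; rewrite ltNge; apply/negP => ft.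
  have : t <= t0 by apply: ub_le_sup => //; split=> //; rewrite tt1 (le_trans t0_ge0)// ltW.
  by rewrite leNgt t0t.
(* A strict inequality [phi t0 < f t0] would persist near [t0], but [S] has points arbitrarily close
   to its supremum. *)
have ft0 : f t0 <= phi t0.
  rewrite leNgt; apply/negP => ft0.
  pose e := (f t0 - phi t0) / 2; have e0 : 0 < e by rewrite divr_gt0// subr_gt0.
  have [d d0 fd] := fc t0 t0I e e0; have [d' d'0 phid] := phic t0 t0I e e0.
  have dd : 0 < Num.min d d' by rewrite lt_min d0.
  have [s [sI fs] ts] := sup_adherent dd supS.
  have st0 : s <= t0 by apply: ub_le_sup.
  have : `|s - t0| < Num.min d d' by rewrite distrC ger0_norm ?subr_ge0//; move: ts; rewrite -/t0; lra.
  rewrite lt_min => /andP[sd sd'].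
  have := fd s sI sd; have := phid s sI sd'; rewrite /e !ltr_norml; lra.
have t01 : t0 < t1.
  by rewrite lt_neqAle t0_le andbT; apply/eqP => t0E; move: f1; rewrite ltNge -t0E ft0.
have [L L0 [r r0 FLr]] := FL (phi t0).
have r20 : 0 < r / 2 by rewrite divr_gt0.
have [d d0 fd] := fc t0 t0I _ r20; have [d' d'0 phid] := phic t0 t0I _ r20.
(* Conversely [f t0 < phi t0] would persist beyond [t0], where [phi < f]. *)
have phift0 : phi t0 <= f t0.
  rewrite leNgt; apply/negP => ft0'.
  pose e := (phi t0 - f t0) / 2; have e0 : 0 < e by rewrite divr_gt0// subr_gt0.
  have [c c0 fdc] := fc t0 t0I e e0; have [c' c'0 phidc] := phic t0 t0I e e0.
  pose q := Num.min (t1 - t0) (Num.min c c') / 2.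
  have q0 : 0 < q by rewrite divr_gt0// !lt_min subr_gt0 t01 c0 c'0.
  have : q * 2 <= Num.min (t1 - t0) (Num.min c c') by rewrite /q divfK.
  rewrite !le_min => /and3P[q1 q2 q3].
  have qI : 0 <= t0 + q <= t1 by apply/andP; split; lra.
  have qd : `|t0 + q - t0| = q by rewrite addrAC subrr add0r gtr0_norm.
  have := fdc _ qI; have := phidc _ qI; rewrite qd !ltr_norml.
  have := after (t0 + q); rewrite /e; lra.
(* The step is short enough to stay before [t1], to have [L * q <= 4^-1], and to keep [f] and [phi]
   within [r / 2] of their common value. *)
pose q := Num.min (Num.min (t1 - t0) (L^-1 / 4)) (Num.min d d') / 2.
have q0 : 0 < q by rewrite divr_gt0// !lt_min subr_gt0 t01 d0 d'0 divr_gt0// invr_gt0 L0.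
have : q * 2 <= Num.min (Num.min (t1 - t0) (L^-1 / 4)) (Num.min d d') by rewrite /q divfK.
rewrite !le_min => /andP[/andP[q1 q2] /andP[q3 q4]].
pose t2 := t0 + q.
have t02 : t0 < t2 by rewrite ltrDl.
have t21 : t2 <= t1 by rewrite /t2; lra.
have sub t : t0 <= t <= t2 -> 0 <= t <= t1.
  by move=> /andP[ta tb]; rewrite (le_trans t0_ge0 ta) (le_trans tb).
have subd t : t0 <= t <= t2 -> `|t - t0| < d /\ `|t - t0| < d'.
  move=> /andP[ta tb]; rewrite ger0_norm ?subr_ge0//.
  by move: tb; rewrite /t2; split; lra.
suff : f t2 <= phi t2 by rewrite leNgt after.
apply: (@ode_comparison_local F f phi t0 t2 L) => //.
- rewrite /t2 addrAC subrr add0r mulrC -ler_pdivlMr//; lra.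
- apply/within_continuous_itvP => t /sub tI e /(fc t tI)[c c0 cP].
  by exists c => // s /sub; apply: cP.
- apply/within_continuous_itvP => t /sub tI e /(phic t tI)[c c0 cP].
  by exists c => // s /sub; apply: cP.
- move=> t /andP[ta tb] phif.
  have tI : t0 <= t <= t2 by rewrite ltW.
  have [td td'] := subd t tI; have := fd t (sub t tI) td; have := phid t (sub t tI) td'.
  have fphi : f t0 = phi t0 by apply/eqP; rewrite eq_le ft0.
  rewrite fphi => h1 h2.
  rewrite -[f t - _]ger0_norm; last by rewrite subr_ge0 ltW.
  by rewrite (le_trans (ler_norm _))// FLr//; lra.
- move=> t /andP[ta tb] e e0.
  have [|c c0 cP] := hf t _ e e0; first by rewrite (le_lt_trans t0_ge0)// (le_trans tb).
  exists c => // s /andP[sa sb]; apply: cP.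
  by rewrite sb (le_trans t0_ge0).
- move=> t /andP[ta tb] e e0.
  have [|c c0 cP] := hphi t _ e e0; first by rewrite (le_lt_trans t0_ge0)// (le_trans tb).
  exists c => // s /andP[sa sb]; apply: cP.
  by rewrite sb (le_trans t0_ge0).
Qed.

End Comparison.

(** * Suprema of families of functions of time *)

Section Modulus.
Context {R : realType}.

Definition modulus (w : R -> R) :=
  (forall r s, 0 <= r -> r <= s -> w r <= w s) /\
  (forall e, 0 < e -> exists2 d, 0 < d & forall r, 0 <= r < d -> w r <= e).

Lemma modulus_powR (K alpha : R) : 0 <= K -> 0 < alpha ->
  modulus (fun r => K * (r `^ alpha)).
Proof.
move=> K0 a0; split=> [r s r0 rs|e e0].
  rewrite ler_wpM2l//; apply: ge0_ler_powR; rewrite ?nnegrE ?(ltW a0)//.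
  exact: le_trans rs.
(* Dividing by [K + 1] covers [K = 0]. *)
pose c := e / (K + 1).
have K1 : 0 < K + 1 by rewrite ltr_wpDl.
have c0 : 0 < c by rewrite divr_gt0.
exists (c `^ alpha^-1); first by rewrite powR_gt0.
move=> r /andP[r0 rc].
have : r `^ alpha <= c.
  rewrite -[leRHS]powRr1 ?(ltW c0)// -(@mulVf _ alpha) ?gt_eqF// powRrM.
  by apply: ge0_ler_powR; rewrite ?nnegrE ?powR_ge0 ?(ltW a0) ?(ltW rc).
move=> h; rewrite (@le_trans _ _ ((K + 1) * c))//; last by rewrite /c mulrC divfK// gt_eqF.
by rewrite ler_pM// ?powR_ge0// lerDl.
Qed.

(* If [~ derivable f t 1] then [a] jumps at [t]; rational numbers
   [q1 < t < q2] and [p] with [a < p] on [(q1, t)] and [p < a] on [(t, q2)]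
   determine [t]. *)
Lemma countable_not_derivable (D : set R) (f a : R -> R) :
  (forall t0, D t0 -> exists r w, [/\ 0 < r, modulus w &
    forall s t, `|s - t0| < r -> `|t - t0| < r ->
      f t + a t * (s - t) - w `|s - t| * `|s - t| <= f s]) ->
  countable [set t | D t /\ ~ derivable f t 1].
Proof.
move=> subgrad.
have jump t0 : D t0 -> ~ derivable f t0 1 -> exists q1 q2 p : rat,
    [/\ ratr q1 < t0, t0 < ratr q2,
        forall s, ratr q1 < s < t0 -> a s < ratr p &
        forall s, t0 < s < ratr q2 -> ratr p < a s].
  move=> Dt0 ndiff; apply: contrapT => nojump; apply: ndiff.
  (* Density of the rationals: if no rational triple separates the two sides of [t0], no real one
     does with a gap [p1 < p2]. *)
  have {}nojump q1 q2 p1 p2 : q1 < t0 -> t0 < q2 -> p1 < p2 ->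
      (forall s, q1 < s < t0 -> a s <= p1) ->
      (forall s, t0 < s < q2 -> p2 <= a s) -> False.
    move=> q1t q2t p12 h1 h2; have [r1] := rat_in_itvoo q1t.
    have [r2] := rat_in_itvoo q2t; have [p] := rat_in_itvoo p12.
    rewrite !in_itv/= => /andP[p1p pp2] /andP[tr2 rq2] /andP[qr1 r1t].
    apply: nojump; exists r1, r2, p; split=> // s /andP[s1 s2].
      by rewrite (le_lt_trans (h1 s _))// s2 (lt_trans qr1).
    by rewrite (lt_le_trans pp2)// h2// s1 (lt_trans s2).
  have [r [w [r0 wm sub]]] := subgrad t0 Dt0.
  suff : is_derive t0 1 f (a t0) by case.
  apply/is_deriveP => e e0.
  have e16 : 0 < e / 16 by rewrite divr_gt0.
  have [d1 d10 wd] := wm.2 _ e16.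
  pose d := Num.min r d1 / 2.
  have d0 : 0 < d by rewrite divr_gt0// lt_min r0.
  have : d * 2 <= Num.min r d1 by rewrite /d divfK.
  rewrite le_min => /andP[dr dd1].
  (* Adding the subgradient inequalities for the pairs [(s, t)] and [(t, s)] shows that [a] is
     nondecreasing up to [e / 8]. *)
  have near s t : `|s - t0| < d -> `|t - t0| < d -> s < t -> a s <= a t + e / 8.
    move=> sd td st; have st0 : 0 < t - s by rewrite subr_gt0.
    have := sub s t; have := sub t s; rewrite (distrC s t) (gtr0_norm st0).
    have wst : w (t - s) <= e / 16.
      by apply: wd; rewrite ltW//=; move: sd td; rewrite !ltr_norml; lra.
    have : w (t - s) * (t - s) <= e / 16 * (t - s) by rewrite ler_wpM2r// ltW.
    move=> h1 h2 h3.
    have : (a s - a t) * (t - s) <= e / 8 * (t - s) by lra.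
    by rewrite ler_pM2r// lerBlDl.
  have near0 : `|t0 - t0| < d by rewrite subrr normr0.
  (* Otherwise near-monotonicity keeps [a] below [a t0 - 3 * e / 8] on a whole left interval and
     above [a t0 - e / 8] on a right one, a jump. The right side is symmetric. *)
  have [dl dl0 left] : exists2 dl, 0 < dl & forall s, t0 - dl < s < t0 -> a t0 - e / 2 <= a s.
    apply: contrapT => H.
    apply: (nojump (t0 - d) (t0 + d) (a t0 - e / 2 + e / 8) (a t0 - e / 8)); first lra.
    - lra.
    - lra.
    - move=> s /andP[s1 s2]; rewrite leNgt; apply/negP => as1; apply: H.
      exists (t0 - s); first by rewrite subr_gt0.
      move=> s' /andP[s1' s2'].
      have ss' : s < s' by lra.
      have := near s s' _ _ ss'; rewrite !ltr_norml; lra.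
    - move=> s /andP[s1 s2].
      have := near t0 s near0 _ s1; rewrite ltr_norml; lra.
  have [dr' dr0 right] : exists2 dr, 0 < dr & forall s, t0 < s < t0 + dr -> a s <= a t0 + e / 2.
    apply: contrapT => H.
    apply: (nojump (t0 - d) (t0 + d) (a t0 + e / 8) (a t0 + e / 2 - e / 8)); first lra.
    - lra.
    - lra.
    - move=> s /andP[s1 s2].
      have := near s t0 _ near0 s2; rewrite ltr_norml; lra.
    - move=> s /andP[s1 s2]; rewrite leNgt; apply/negP => as1; apply: H.
      exists (s - t0); first by rewrite subr_gt0.
      move=> s' /andP[s1' s2'].
      have ss' : s' < s by lra.
      have := near s' s _ _ ss'; rewrite !ltr_norml; lra.
  exists (Num.min d (Num.min dl dr')); first by rewrite !lt_min d0 dl0.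
  move=> s _; rewrite !lt_min => /and3P[sd sdl sdr].
  have sr : `|s - t0| < r by lra.
  have t0r : `|t0 - t0| < r by rewrite subrr normr0.
  have ws : w `|s - t0| * `|s - t0| <= e / 16 * `|s - t0|.
    by rewrite ler_wpM2r// wd// normr_ge0/=; lra.
  have lo := sub s t0 sr t0r; have := sub t0 s t0r sr; rewrite (distrC t0) => hi.
  suff : (a s - a t0) * (s - t0) <= e / 2 * `|s - t0|.
    by rewrite ler_norml; have := normr_ge0 (s - t0); nra.
  case: (ltgtP s t0) => [st|ts|->]; last by rewrite !subrr normr0 !mulr0.
    rewrite ltr0_norm ?subr_lt0// in sdl *.
    have : a t0 - e / 2 <= a s by apply: left; lra.
    nra.
  rewrite gtr0_norm ?subr_gt0// in sdr *.
  by rewrite ler_wpM2r ?subr_ge0 ?(ltW ts)// lerBlDl right; lra.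
(* The triple [(0, 0, 0)] is a default for the other times. *)
have /choice[tr trP] : forall t, exists x : rat * rat * rat,
    D t /\ ~ derivable f t 1 ->
    [/\ ratr x.1.1 < t, t < ratr x.1.2,
        forall s, ratr x.1.1 < s < t -> a s < ratr x.2 &
        forall s, t < s < ratr x.1.2 -> ratr x.2 < a s].
  move=> t.
  have [Dt|nDt] := pselect (D t /\ ~ derivable f t 1); last by exists (0, 0, 0).
  by have [q1 [q2 [p ?]]] := jump t Dt.1 Dt.2; exists (q1, q2, p).
apply/countable_injP; exists (pickle \o tr).
(* If [s < t] shared a triple, their midpoint would lie right of [s] and left of [t] within both
   windows, so [a] would be above and below [p] there. *)
have lt_case s t : D s /\ ~ derivable f s 1 -> D t /\ ~ derivable f t 1 ->
    tr s = tr t -> s < t -> False.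
  move=> /trP[s1 _ _ s4] /trP[_ t2 t3 _] st_eq st; rewrite st_eq in s1 s4.
  have := s4 ((s + t) / 2); have := t3 ((s + t) / 2); lra.
move=> s t /[!inE] Ds Dt /(pcan_inj pickleK) st_eq.
case: (ltgtP s t) => // h; exfalso.
- exact: (lt_case s t).
- exact: (lt_case t s).
Qed.

End Modulus.

(** * Families with bounded and uniformly equicontinuous time derivatives *)

Section SupOfFamily.
Context {R : realType} {J : Type} (u v : J -> R -> R).

Let f t := sup (range (u ^~ t)).

(** The limit points of [v x_k t] along sequences [x_k] maximizing [u (., t)], in quantifier
    form. *)
Definition sup_slope t a :=
  forall e, 0 < e -> exists x, f t - e < u x t /\ `|v x t - a| < e.

Context (x0 : J) (b K : R) (w : R -> R).
Context (b_ge0 : 0 <= b) (w_modulus : modulus w).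
Context (u_bounded : exists B, forall x, u x b <= B).
Let I := [set s : R | 0 <= s <= b].
Context (uv : forall x s, I s -> linear_approx I (u x) s (v x s)).
Context (v_bounded : forall x s, I s -> `|v x s| <= K).
Context (v_modulus : forall x s t, I s -> I t -> `|v x s - v x t| <= w `|s - t|).

Lemma family_MVT x s t : I s -> I t -> exists2 c,
  I c /\ `|c - t| <= `|s - t| & u x s - u x t = v x c * (s - t).
Proof.
have lt_case r q : I r -> I q -> r < q -> exists2 c, r < c < q & u x q - u x r = v x c * (q - r).
  move=> /andP[r0 rb] /andP[q0 qb] rq.
  have rqI y : r <= y <= q -> I y.
    by move=> /andP[ry yq]; rewrite /I/= (le_trans r0)// (le_trans yq).
  by apply: (MVT_approx rq rqI) => y /rqI; apply: uv.
move=> Is It; case: (ltgtP s t) => [st|ts|->].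
- have [c /andP[sc ct] cE] := lt_case _ _ Is It st.
  exists c; last by lra.
  split; last by rewrite !ler0_norm; lra.
  by move: Is It; rewrite /I/=; lra.
- have [c /andP[sc ct] cE] := lt_case _ _ It Is ts.
  exists c => //.
  split; last by rewrite !ger0_norm; lra.
  by move: Is It; rewrite /I/=; lra.
- by exists t; [split|rewrite !subrr mulr0].
Qed.

Lemma family_lipschitz x s t : I s -> I t -> `|u x s - u x t| <= K * `|s - t|.
Proof.
move=> Is It; have [c [Ic _] ->] := family_MVT x Is It.
by rewrite normrM ler_wpM2r// v_bounded.
Qed.

(** The mean value point is no farther from [t] than [s] is, and [w] is nondecreasing. *)
Lemma family_taylor x s t : I s -> I t ->
  `|u x s - u x t - v x t * (s - t)| <= w `|s - t| * `|s - t|.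
Proof.
move=> Is It; have [c [Ic ct] ->] := family_MVT x Is It.
rewrite -mulrBl normrM ler_wpM2r// (le_trans (v_modulus x Ic It))//.
exact: w_modulus.1.
Qed.

(** Boundedness is assumed at the single time [b], as the bound on [u] is given for positive times;
    the Lipschitz estimate carries it to all of [I], including time [0]. *)
Lemma has_sup_family t : I t -> has_sup (range (u ^~ t)).
Proof.
move=> It; split; first by exists (u x0 t), x0.
have Ib : I b by rewrite /I/= b_ge0 lexx.
have [B uB] := u_bounded; exists (B + K * `|t - b|) => _ [x _ <-].
have := family_lipschitz x It Ib; rewrite ler_norml => /andP[_].
have := uB x; lra.
Qed.

Lemma le_sup_family x t : I t -> u x t <= f t.
Proof. by move=> /has_sup_family[_ ?]; apply: ub_le_sup => //; exists x. Qed.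

Lemma sup_family_lipschitz s t : I s -> I t -> `|f s - f t| <= K * `|s - t|.
Proof.
have half r q : I r -> I q -> f r - f q <= K * `|r - q|.
  move=> Ir Iq; rewrite lerBlDl; apply: ge_sup => [|_ [x _ <-]].
    by exists (u x0 r), x0.
  have := family_lipschitz x Ir Iq; rewrite ler_norml => /andP[_].
  have := le_sup_family x Iq; lra.
move=> Is It; rewrite ler_norml half// andbT.
by have := half _ _ It Is; rewrite distrC; lra.
Qed.

Lemma sup_slope_subgradient s t a : I s -> I t -> sup_slope t a ->
  f t + a * (s - t) - w `|s - t| * `|s - t| <= f s.
Proof.
move=> Is It ta; apply/ler_addgt0Pr => e e0.
pose e' := e / (1 + `|s - t|).
have n0 : 0 < 1 + `|s - t| by rewrite ltr_wpDr.
have e'0 : 0 < e' by rewrite divr_gt0.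
have [x [ux vx]] := ta _ e'0.
have := family_taylor x Is It; rewrite ler_norml => /andP[h _].
have := le_sup_family x Is.
have : (a - v x t) * (s - t) <= e' * `|s - t|.
  rewrite (le_trans (ler_norm _))// normrM ler_wpM2r// distrC ltW//.
have : e' + e' * `|s - t| = e by rewrite -[X in X + _]mulr1 -mulrDr /e' divfK// gt_eqF.
lra.
Qed.

(** Bolzano-Weierstrass for the bounded sequence [v (x_ k) t]. The second conclusion keeps the link
    with the given sequence, so that estimates along it pass to [a]. *)
Lemma exists_sup_slope t (x_ : nat -> J) : I t ->
  (forall e, 0 < e -> exists N, forall k, (N <= k)%N -> f t - e < u (x_ k) t) ->
  exists2 a, sup_slope t a &
    forall e N, 0 < e -> exists2 k, (N <= k)%N & `|v (x_ k) t - a| < e.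
Proof.
move=> It x_max.
have [|g gincr /cvg_ex[/= a ga]] := @bolzano_weierstrass R (fun k => v (x_ k) t).
  exists K; split; first exact: num_real.
  by move=> y Ky k _ /=; rewrite (le_trans (v_bounded _ It))// ltW.
have acc e N : 0 < e -> exists2 k, (N <= k)%N & `|v (x_ k) t - a| < e.
  move=> e0; move/cvgrPdist_lt : ga => /(_ e e0)[N' _ N'P].
  exists (g (maxn N N')); last by rewrite distrC; apply: N'P => /=; rewrite leq_maxr.
  rewrite (leq_trans (leq_maxl N N'))//; exact: (unstable.mono_leq_infl gincr).
exists a => // e e0; have [N NP] := x_max e e0.
by have [k Nk ka] := acc e N e0; exists (x_ k); split=> //; apply: NP.
Qed.

Lemma maximizing_sequence t : I t -> exists x_ : nat -> J,
  forall e, 0 < e -> exists N, forall k, (N <= k)%N -> f t - e < u (x_ k) t.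
Proof.
move=> It.
have ex k : exists x, f t - k.+1%:R^-1 < u x t.
  have k0 : 0 < k.+1%:R^-1 :> R by rewrite invr_gt0.
  by have [_ [x _ <-]] := sup_adherent k0 (has_sup_family It); exists x.
have [x_ xP] := choice ex; exists x_ => e e0.
have [N _ NP] := near_infty_natSinv_lt (PosNum e0).
exists N => k Nk; apply: lt_trans (xP k).
by rewrite ltrD2l ltrN2; apply: NP.
Qed.

(* [u x s <= f s] and Taylor's formula at [t] squeeze [v x t] between the
   difference quotients of [f] on both sides of [t]. *)
Lemma deriv_sup_family t l (x_ : nat -> J) : 0 < t < b ->
  linear_approx setT f t l ->
  u (x_ k) t @[k --> \oo] --> f t ->
  v (x_ k) t @[k --> \oo] --> l.
Proof.
move=> /andP[t0 tb] fl /cvgrPdist_lt ux; apply/cvgrPdist_le => e e0.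
have It : I t by rewrite /I/= !ltW.
have e3 : 0 < e / 3 by rewrite divr_gt0.
have [d1 d10 d1P] := fl _ e3; have [d2 d20 d2P] := w_modulus.2 _ e3.
pose q := Num.min (Num.min t (b - t)) (Num.min d1 d2) / 2.
have q0 : 0 < q by rewrite divr_gt0// !lt_min t0 subr_gt0 tb d10 d20.
have : q * 2 <= Num.min (Num.min t (b - t)) (Num.min d1 d2) by rewrite /q divfK.
rewrite !le_min => /andP[/andP[q1 q2] /andP[q3 q4]].
have wq : w q <= e / 3 by apply: d2P; rewrite ltW//=; lra.
near=> k.
(* The gap must be small relative to [q], because the estimate is divided by [q] at the end. The
   other two thirds come from the Taylor error and from the differentiability of [f]. *)
have uk : f t - u (x_ k) t < e / 3 * q.
  apply: le_lt_trans (ler_norm _) _.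
  near: k; apply: ux; exact: mulr_gt0.
have Iq s : `|s - t| = q -> I s /\ `|f s - f t - l * (s - t)| <= e / 3 * q.
  move=> sq; split; last by rewrite -sq; apply: d1P => //; lra.
  have := lexx q; rewrite -[in X in X -> _]sq /I/= ler_norml; lra.
have key s : `|s - t| = q -> (v (x_ k) t - l) * (s - t) <= e * q.
  move=> sq; have [Is] := Iq s sq; rewrite ler_norml => /andP[_ fs].
  have := family_taylor (x_ k) Is It; rewrite sq ler_norml => /andP[us _].
  have := le_sup_family (x_ k) Is.
  have : w q * q <= e / 3 * q by rewrite ler_wpM2r// ltW.
  lra.
have h1 := key (t + q); have h2 := key (t - q).
rewrite addrAC subrr add0r gtr0_norm// ler_pM2r// in h1.
rewrite addrAC subrr add0r normrN gtr0_norm// mulrN -mulNr ler_pM2r// in h2.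
rewrite distrC ler_norml h1// andbT; have := h2 erefl; lra.
Unshelve. all: by end_near. Qed.

End SupOfFamily.

(** * Geometry *)

Section Geometry.
Context {R : realType} {n : nat} (M : manifold R n).

Lemma curve_length_ge0 (g : components2 M) x y L :
  curve_length g x y L -> (0 <= L)%E.
Proof.
elim=> // i c {}y {}L _ _ _ L0; rewrite adde_ge0// /segment_length.
by apply: integral_ge0 => s _; rewrite lee_fin sqrtr_ge0.
Qed.

Lemma dist_ge0 (g : components2 M) x y : (0 <= Defs.dist g x y)%E.
Proof. by apply: le_ereal_inf_tmp => L /curve_length_ge0. Qed.

Lemma dist_refl (g : components2 M) x : Defs.dist g x x = 0%E.
Proof.
apply/eqP; rewrite eq_le dist_ge0 andbT; apply: ereal_inf_lbound.
exact: curve_nil.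
Qed.

(** Over a fixed point of [M] the space-time Hoelder condition thus becomes one in time, with a
    constant independent of the point. *)
Lemma spacetime_dist_same_point (g : components2 M) x (s t : R) :
  spacetime_dist g (x, s) (x, t) = (`|s - t|)%:E.
Proof.
rewrite /spacetime_dist /= dist_refl mul0e add0e poweR_EFin.
by rewrite powR12_sqrt ?sqr_ge0// sqrtr_sqr.
Qed.

Lemma holder_norm_bounds (g : components2 M) (alpha t K : R)
    (f : M -> R -> R) (x0 : M) : 0 < t -> (holder_norm g alpha t f <= K%:E)%E ->
  (forall x s, 0 <= s <= t -> `|f x s| <= K) /\
  (forall x s r, 0 <= s <= t -> 0 <= r <= t ->
    `|f x s - f x r| <= K * `|s - r| `^ alpha).
Proof.
move=> t0; rewrite /holder_norm.
set S1 := ereal_sup _; set S2 := ereal_sup _ => SK.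
have I0 : 0 <= (0 : R) <= t by rewrite lexx ltW.
have It : 0 <= t <= t by rewrite lexx andbT ltW.
have S1le x s : 0 <= s <= t -> (`|f x s|%:E <= S1)%E.
  by move=> st; apply: ereal_sup_ubound; exists (x, s).
have S2le x s r : 0 <= s <= t -> 0 <= r <= t -> s != r ->
    (`|f x s - f x r|%:E * inve (poweR `|s - r|%:E alpha) <= S2)%E.
  move=> st rt sr; apply: ereal_sup_ubound.
  exists ((x, s), (x, r)); last by rewrite spacetime_dist_same_point.
  by split=> //= -[] /eqP; rewrite (negPf sr).
(* Each supremum is bounded by the sum once the other is nonnegative, which takes an element of each
   set: for the second, the distinct points over [x0] at times [0] and [t]. *)
have S10 : (0 <= S1)%E by apply: le_trans (S1le x0 0 I0); rewrite lee_fin.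
have S20 : (0 <= S2)%E.
  apply: le_trans (S2le x0 t 0 It I0 _); last by rewrite gt_eqF.
  by rewrite mule_ge0// inve_ge0 poweR_ge0.
have bound x s : 0 <= s <= t -> `|f x s| <= K.
  move=> st; rewrite -lee_fin (le_trans (S1le x s st))//.
  by rewrite (le_trans _ SK)// leeDl.
split=> // x s r st rt; have [->|sr] := eqVneq s r.
  rewrite !subrr normr0 mulr_ge0 ?powR_ge0//.
  exact: le_trans (bound x s st).
have sr0 : 0 < `|s - r| `^ alpha by rewrite powR_gt0// normr_gt0 subr_eq0.
have : (`|f x s - f x r|%:E * inve (poweR `|s - r|%:E alpha) <= K%:E)%E.
  by rewrite (le_trans (S2le x s r st rt sr))// (le_trans _ SK)// leeDr.
by rewrite poweR_EFin inver gt_eqF// lee_fin ler_pdivrMr.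
Qed.

Lemma smooth_spacetime_C2 (T : \bar R) (u : M -> R -> R) t :
  smooth_spacetime T u -> times T t -> C2 (u ^~ t).
Proof.
move=> us tT i; apply: Ck_local => y yi.
have [//|U [h [[oU Uy] hC hu]]] := us i (y, t).
exists ([set z | U (z, t)] `&` chart_image i), (fun z => h (z, t)); split.
- split; last by split.
  apply: openI; last exact: mimage_open.
  apply: (@open_comp _ _ (fun z => (z, t))) => // z _.
  exact: continuous_pairl.
- by apply: Ck_sub (Ck_slice t (hC 2)) => z [].
- by move=> z [Uz iz]; rewrite hu.
Qed.

(** No time of [[0, T)] is isolated on its right, so limits that define relative derivatives are
    unique. *)
Lemma times_proper (T : \bar R) t : times T t ->
  ProperFilter (within (times T) t^').
Proof.
move=> [t0 tT]; split; last exact: within_filter.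
move=> [d /= d0 dP].
have [s ts sT] : exists2 s, t < s < t + d & (s%:E < T)%E.
  move: T tT {dP} => [T| |]//= tT; last first.
    by exists (t + d / 2); [lra|rewrite ltry].
  rewrite lte_fin in tT; pose e := Num.min d (T - t) / 2.
  have e0 : 0 < e by rewrite divr_gt0// lt_min d0 subr_gt0.
  have : e * 2 <= Num.min d (T - t) by rewrite /e divfK.
  rewrite le_min => /andP[e1 e2].
  by exists (t + e); [lra|rewrite lte_fin; lra].
apply: (dP s); first by rewrite /ball_/= ltr_norml; lra.
- by rewrite gt_eqF//; case/andP: ts.
- by split=> //; lra.
Qed.

(** [time_deriv] is a bare [lim]. A smooth local extension in a chart shows that the limit exists,
    also one-sidedly at [t = 0], and identifies it. *)
Lemma smooth_time_deriv (T : \bar R) (u : M -> R -> R) x t :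
  smooth_spacetime T u -> times T t ->
  linear_approx (times T) (u x) t (time_deriv T u x t).
Proof.
move=> us tT; have [i ix] := mcover x; pose y := mchart i x.
have yi : chart_image i y by exists x.
have [//|U [h [[oU Uy] hC hu]]] := us i (y, t).
pose l := 'D_(0, 1) h (y, t).
have hl : is_derive t 1 (fun s => h (y, s)) l.
  have shiftE : (fun r : R => r^-1 *: (((fun s => h (y, s)) \o shift t) (r *: 1) - h (y, t))) =
      (fun r => r^-1 *: ((h \o shift (y, t)) (r *: (0, 1)) - h (y, t))).
    apply/funext => r /=; congr (_ *: (h _ - _)).
    by rewrite /shift/= /GRing.scale/= /GRing.add/= /add_pair /scale_pair /= scaler0 add0r.
  split; last by rewrite /derive shiftE.
  by rewrite /derivable shiftE; apply: ((hC 1%N).2 (0, 1)).1.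
have ul : linear_approx (times T) (u x) t l.
  have [d0 d00 dU] : exists2 d, 0 < d & forall s, `|s - t| < d -> U (y, s).
    have : nbhs (y, t) U by apply: open_nbhs_nbhs.
    move=> [[A B] /= [Ay Bt] AB]; have [d /= d0 dB] := Bt.
    exists d => // s st; apply: AB; split => /=; first exact: nbhs_singleton.
    by apply: dB; rewrite /ball_/= distrC.
  have us' s : times T s -> `|s - t| < d0 -> u x s = h (y, s).
    by move=> sT sd; rewrite hu ?mchartK//; apply: dU.
  move/is_deriveP: hl => hl e e0; have [d1 d10 d1P] := hl e e0.
  exists (Num.min d0 d1); first by rewrite lt_min d00.
  move=> s sT; rewrite lt_min => /andP[s0 s1].
  rewrite !us'// ?subrr ?normr0//; exact: d1P.
suff -> : time_deriv T u x t = l by [].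
have := times_proper tT => ?.
by apply: cvg_lim => //; apply/has_deriv_inP.
Qed.

Lemma hess_contract_le (g h : components2 M) f x (e C0 : R) : 0 <= e ->
  posdef_tensor2 g -> posdef_tensor2 h -> norm2 g h x <= C0 ->
  (forall v, v != 0 -> form (hessian g (chart_at x) f x) v v <
    e * form (g (chart_at x) x) v v) ->
  hess_contract g h f x <= e * ((C0 ^+ 2 + n%:R) / 2).
Proof.
move=> e0 [_ /(_ x (chart_at x)) gP] [_ /(_ x (chart_at x)) hP] hC0 hess.
have ix : mdom (chart_at x) x by rewrite /chart_at; case: cid.
have := contract_le e0 (gP ix) (hP ix) hess erefl.
move=> /le_trans; apply; rewrite ler_wpM2l// ler_pM2r// lerD2r.
move: hC0; rewrite /norm2 -/(raise g h (chart_at x) x).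
(* [Num.sqrt] sends negative numbers to [0], hence the separate, trivial case [q < 0]. *)
set q := \sum_a _; have [q0|q0] := leP 0 q; last by rewrite (le_trans (ltW q0))// sqr_ge0.
move=> qC; rewrite -(sqr_sqrtr q0) ler_sqr ?nnegrE ?sqrtr_ge0//.
exact: le_trans qC.
Qed.

Lemma inner_le (g : components2 M) x v w (K e : R) :
  posdef_tensor2 g -> vnorm g x v <= K -> vnorm g x w <= e ->
  inner g x v w <= K * e.
Proof.
move=> [_ /(_ x (chart_at x)) gP] vK we.
have ix : mdom (chart_at x) x by rewrite /chart_at; case: cid.
apply: le_trans (form_CauchySchwarz _ _ (gP ix)) _.
by rewrite ler_pM ?sqrtr_ge0.
Qed.

(** The principle produces points even for a constant function, which excludes an empty manifold. *)
Lemma omori_yau_inhabited (g : components2 M) : omori_yau g -> exists x : M, True.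
Proof.
move=> /(_ (fun=> 0))[].
- by move=> i; apply: Ck_cst.
- by exists 0.
- by move=> x_ _; exists (x_ 0).
Qed.

End Geometry.

(** * Local Lipschitz bounds, time intervals, null sets, and the theorem *)

Section Main.
Context {R : realType}.

Lemma linear_approx_sub (A B : set R) (f : R -> R) t l :
  A `<=` B -> linear_approx B f t l -> linear_approx A f t l.
Proof. by move=> AB fl e /fl[d d0 dP]; exists d => // s /AB; apply: dP. Qed.

Lemma locally_lipschitzP (F : R -> R) :
  [locally [lipschitz F r | r in [set: R]]] ->
  forall y, exists2 L, 0 < L & exists2 r, 0 < r & forall y1 y2,
    `|y1 - y| < r -> `|y2 - y| < r -> `|F y1 - F y2| <= L * `|y1 - y2|.
Proof.
move=> FL y; have [L0 [_ L0P]] := FL (y, y) (conj I I).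
(* Above the threshold [L0] and positive whatever the sign of [L0]. *)
pose L := Num.max L0 0 + 1.
have L0L : L0 < L by rewrite ltr_pwDr// le_max lexx.
have Lpos : 0 < L by rewrite ltr_pwDr// le_max lexx orbT.
have [[A B] /= [[d1 /= d10 d1P] [d2 /= d20 d2P]] AB] := L0P L L0L.
exists L => //; exists (Num.min d1 d2); first by rewrite lt_min d10.
move=> y1 y2; rewrite !lt_min => /andP[y11 _] /andP[_ y22].
apply: (AB (y1, y2)) => //; split => /=.
- by apply: d1P; rewrite /ball_/= distrC.
- by apply: d2P; rewrite /ball_/= distrC.
Qed.

(** Estimates are made on intervals [[0, b]]. Asking [0 < b] lets the bounds for positive times
    apply even when [t = 0]. *)
Lemma times_between (T : \bar R) t : times T t ->
  exists2 b, t < b & 0 < b /\ (b%:E < T)%E.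
Proof.
move=> [t0]; case: T => [T| |]//= tT; last first.
  by exists (t + 1); [lra|split; [lra|rewrite ltry]].
rewrite lte_fin in tT.
by exists ((t + T) / 2); [lra|rewrite lte_fin; split; lra].
Qed.

Lemma countable_negligible (A : set R) :
  countable A -> lebesgue_measure.-negligible A.
Proof.
move=> cA; exists A; split=> //.
- by apply: countable_measurable => // t; exact: measurable_set1.
- exact: countable_lebesgue_measure0.
Qed.

End Main.

Theorem theorem2 (R : realType) (n : nat) (M : manifold R n) (T : \bar R)
  (T_gt0 : (0 < T)%E)
  (g : R -> components2 M)
  (g_smooth : smooth_metric_family T g)
  (g_omori_yau : forall t, times T t -> omori_yau (g t))
  (u : M -> R -> R)
  (u_smooth : smooth_spacetime T u)
  (C C1 : R -> R) (C0 alpha : R)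
  (alpha_gt0 : 0 < alpha) (alpha_le1 : alpha <= 1)
  (u_bound : forall t x, 0 < t -> (t%:E < T)%E -> `|u x t| <= C t)
  (grad_bound : forall t x, 0 < t -> (t%:E < T)%E ->
    vnorm (g t) x (grad (g t) (u ^~ t) x) <= C t)
  (ut_holder : forall t, 0 < t -> (t%:E < T)%E ->
    (holder_norm (g t) alpha t (time_deriv T u) <= (C t)%:E)%E)
  (X : M -> R -> components M -> R -> components M)
  (X_tangent : forall x r p t, times T t -> tangent x p -> tangent x (X x r p t))
  (X_bound : forall t x, times T t ->
    vnorm (g t) x (X x (u x t) (grad (g t) (u ^~ t) x) t) <= C1 t)
  (F : R -> R)
  (F_lipschitz : [locally [lipschitz F r | r in [set: R]]])
  (H : R -> components2 M)
  (H_posdef : forall t, times T t -> posdef_tensor2 (H t))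
  (H_bound : forall t x, times T t -> norm2 (g t) (H t) x <= C0)
  (u_pde : forall t x, times T t ->
    time_deriv T u x t - hess_contract (g t) (H t) (u ^~ t) x =
    inner (g t) x (X x (u x t) (grad (g t) (u ^~ t) x) t)
                  (grad (g t) (u ^~ t) x)
    + F (u x t)) :
  [/\ [locally [lipschitz (usup u t) | t in times T]],
      {ae lebesgue_measure, forall t : R, times T t -> derivable (usup u) t 1},
      (forall t : R, 0 < t -> (t%:E < T)%E -> derivable (usup u) t 1 ->
        forall x_ : nat -> M,
          u (x_ k) t @[k --> \oo] --> usup u t ->
          time_deriv T u (x_ k) t @[k --> \oo] --> derive1 (usup u) t) &
      (forall (T' : \bar R) (phi : R -> R),
        maximal_ode_solution F (usup u 0) T' phi ->
        forall x t, 0 <= t -> (t%:E < Order.min T T')%E -> u x t <= phi t)].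

Proof.
have [x0 _] : exists x : M, True.
  by apply: omori_yau_inhabited (g_omori_yau 0 _); split.
pose v := time_deriv T u.
have uv x t : times T t -> linear_approx (times T) (u x) t (v x t).
  exact: smooth_time_deriv.
have sub b : (b%:E < T)%E -> [set s | 0 <= s <= b] `<=` times T.
  by move=> bT s /andP[s0 sb]; split=> //; rewrite (le_lt_trans _ bT)// lee_fin.
pose w b r := C b * (r `^ alpha).
have uv_b b x s : (b%:E < T)%E -> 0 <= s <= b ->
    linear_approx [set s | 0 <= s <= b] (u x) s (v x s).
  move=> bT sb; apply: linear_approx_sub (sub b bT) _.
  by apply: uv; apply: sub sb.
have u_b b : 0 < b -> (b%:E < T)%E -> exists B, forall x, u x b <= B.
  by move=> b0 bT; exists (C b) => x; rewrite (le_trans (ler_norm _))// u_bound.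
(* The Hoelder norm at time [b] controls [v] on all of [[0, b]] with the one constant [C b]. *)
have vhold b b0 bT := holder_norm_bounds x0 b0 (ut_holder b b0 bT).
have v_b b x s : 0 < b -> (b%:E < T)%E -> 0 <= s <= b -> `|v x s| <= C b.
  by move=> b0 bT; apply: (vhold b b0 bT).1.
have v_w b x s r : 0 < b -> (b%:E < T)%E -> 0 <= s <= b -> 0 <= r <= b ->
    `|v x s - v x r| <= w b `|s - r|.
  by move=> b0 bT; apply: (vhold b b0 bT).2.
have w_mod b : 0 < b -> (b%:E < T)%E -> modulus (w b).
  move=> b0 bT; apply: modulus_powR => //.
  by apply: le_trans (v_b b x0 b b0 bT _); rewrite // lexx andbT ltW.
have usup_lip b s t : 0 < b -> (b%:E < T)%E -> 0 <= s <= b -> 0 <= t <= b ->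
    `|usup u s - usup u t| <= C b * `|s - t|.
  move=> b0 bT; apply: (@sup_family_lipschitz _ _ u v x0 b) => //.
  - exact: ltW.
  - exact: u_b.
  - by move=> x r; apply: uv_b.
  - by move=> x r; apply: v_b.
have subgrad b s t a : 0 < b -> (b%:E < T)%E -> 0 <= s <= b -> 0 <= t <= b ->
    sup_slope u v t a ->
    usup u t + a * (s - t) - w b `|s - t| * `|s - t| <= usup u s.
  move=> b0 bT; apply: (@sup_slope_subgradient _ _ u v x0 b (C b)) => //.
  - exact: ltW.
  - exact: w_mod.
  - exact: u_b.
  - by move=> x r; apply: uv_b.
  - by move=> x r; apply: v_b.
  - by move=> x r q; apply: v_w.
have maxseq b t : 0 < b -> (b%:E < T)%E -> 0 <= t <= b -> exists x_ : nat -> M,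
    forall e, 0 < e -> exists N, forall k, (N <= k)%N -> usup u t - e < u (x_ k) t.
  move=> b0 bT; apply: (@maximizing_sequence _ _ u v x0 b (C b)) => //.
  - exact: ltW.
  - exact: u_b.
  - by move=> x r; apply: uv_b.
  - by move=> x r; apply: v_b.
have slope_seq b t x_ : 0 < b -> (b%:E < T)%E -> 0 <= t <= b ->
    (forall e, 0 < e -> exists N, forall k, (N <= k)%N -> usup u t - e < u (x_ k) t) ->
    exists2 a, sup_slope u v t a &
      forall e N, 0 < e -> exists2 k, (N <= k)%N & `|v (x_ k) t - a| < e.
  move=> b0 bT tb; apply: (@exists_sup_slope _ _ u v b (C b)) => //.
  by move=> x r; apply: v_b.
split.
(* The local Lipschitz condition is tested near a pair of times, so [b] is taken beyond both. *)
- move=> [t1 t2] /= [t1T t2T].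
  have [b tb [b0 bT]] : exists2 b, Num.max t1 t2 < b & 0 < b /\ (b%:E < T)%E.
    by apply: times_between; case: (leP t1 t2).
  move: tb; rewrite gt_max => /andP[t1b t2b].
  exists (C b); split; first exact: num_real.
  move=> K CK; exists ([set s | s < b], [set s | s < b]).
    by split; apply: lt_nbhsl.
  move=> [s1 s2] /= [s1b s2b] [[s10 _] [s20 _]].
  have s1I : 0 <= s1 <= b by rewrite s10 ltW.
  have s2I : 0 <= s2 <= b by rewrite s20 ltW.
  apply: le_trans (usup_lip b _ _ b0 bT s1I s2I) _.
  by rewrite ler_wpM2r// ltW.
- have [a aP] : exists a : R -> R, forall t, times T t -> sup_slope u v t (a t).
    suff /choice[a aP] : forall t, exists a, times T t -> sup_slope u v t a by exists a.
    move=> t; have [tT|ntT] := pselect (times T t); last by exists 0.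
    have [b tb [b0 bT]] := times_between tT.
    have tI : 0 <= t <= b by rewrite tT.1 ltW.
    have [x_ xP] := maxseq b t b0 bT tI.
    by have [a' ? _] := slope_seq b t x_ b0 bT tI xP; exists a'.
  (* Two-sided subgradient inequalities are available in the open interval only; time [0] is added
     as a null set below. *)
  pose D := [set t : R | 0 < t /\ (t%:E < T)%E].
  have cD : countable [set t | D t /\ ~ derivable (usup u) t 1].
    apply: (@countable_not_derivable R D (usup u) a) => t0 [t00 t0T].
    have t0Tm : times T t0 by split=> //; rewrite ltW.
    have [b tb [b0 bT]] := times_between t0Tm.
    exists (Num.min t0 (b - t0)), (w b); split; last 2 first.
    - exact: w_mod.
    - move=> s t; rewrite !lt_min !ltr_norml => sI tI.
      have sb : 0 <= s <= b by lra.
      have tb' : 0 <= t <= b by lra.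
      by apply: subgrad => //; apply: aP; apply: sub tb'.
    - by rewrite lt_min t00 subr_gt0.
  apply: negligibleS (negligibleU (countable_negligible (@countable1 R 0))
    (countable_negligible cD)).
  move=> t /= /not_implyP[[t0 tT] ndt].
  have [->|tn0] := eqVneq t 0; [by left|right; split=> //].
  by split=> //; rewrite lt_neqAle eq_sym tn0.
- move=> t t0 tT dut x_ xmax.
  have tTm : times T t by split=> //; rewrite ltW.
  have [b tb [b0 bT]] := times_between tTm.
  apply: (@deriv_sup_family _ _ u v x0 b (C b) (w b)) => //.
  - exact: ltW.
  - exact: w_mod.
  - exact: u_b.
  - by move=> x r; apply: uv_b.
  - by move=> x r; apply: v_b.
  - by move=> x r q; apply: v_w.
  - by rewrite t0.
  - by apply/is_deriveP; rewrite derive1E; exact: DeriveDef.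
- move=> T' phi [[T'0 phi0 phi_ode] _] x t t0; rewrite lt_min => /andP[tT tT'].
  have tTm : times T t by [].
  have [b tb [b0 bT]] := times_between tTm.
  have FL := locally_lipschitzP F_lipschitz.
  (* Along the Omori-Yau points the Hessian and gradient terms of the equation are bounded above by
     multiples of [k.+1%:R^-1], so some limit point of [v] is at most [F (usup u s)]. *)
  have slope_le s : 0 < s <= t -> exists2 a, sup_slope u v s a & a <= F (usup u s).
    move=> /andP[s0 st].
    have sI : 0 <= s <= b by rewrite ltW//= (le_trans st)// ltW.
    have sT : times T s by apply: sub sI.
    have [x_ xP] := g_omori_yau s sT _ (smooth_spacetime_C2 u_smooth sT) (u_b s s0 sT.2).
    have inv_small (e : R) : 0 < e -> exists N, forall k, (N <= k)%N -> k.+1%:R^-1 < e.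
      move=> e0; have [N _ NP] := near_infty_natSinv_lt (PosNum e0).
      by exists N => k Nk; apply: NP.
    have [|a aslope aacc] := slope_seq b s x_ b0 bT sI.
      move=> e /inv_small[N NP]; exists N => k Nk; have [uk _ _] := xP k.
      by apply: lt_trans uk; rewrite ltrD2l ltrN2 NP.
    exists a => //; apply/ler_addgt0Pr => e e0.
    have [L L0 [r r0 FLr]] := FL (usup u s).
    (* The summands bound the Hessian term, the term with [X], and the change of [F] from [usup u s]
       to [u (x_ k) s]. *)
    pose K := (C0 ^+ 2 + n%:R) / 2 + C1 s + L.
    have vk k : k.+1%:R^-1 < r -> v (x_ k) s <= F (usup u s) + k.+1%:R^-1 * K.
      move=> kr; have [uk gradk hessk] := xP k.
      have k0 : 0 <= k.+1%:R^-1 :> R by rewrite invr_ge0.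
      have h1 := hess_contract_le k0 (g_smooth.1 s sT) (H_posdef s sT) (H_bound s (x_ k) sT) hessk.
      have h2 := inner_le (g_smooth.1 s sT) (X_bound s (x_ k) sT) (ltW gradk).
      have uk' : u (x_ k) s <= usup u s.
        apply: (@le_sup_family _ _ u v x0 b (C b)) => //.
        - exact: ltW.
        - exact: u_b.
        - by move=> y q; apply: uv_b.
        - by move=> y q; apply: v_b.
      have h3 : F (u (x_ k) s) - F (usup u s) <= L * k.+1%:R^-1.
        have uk2 : `|u (x_ k) s - usup u s| < k.+1%:R^-1.
          by rewrite distrC ger0_norm ?subr_ge0// ltrBlDr -ltrBlDl.
        rewrite (le_trans (ler_norm _))// (le_trans (FLr _ _ _ _))//.
        - exact: lt_trans kr.
        - by rewrite subrr normr0.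
        - by rewrite ler_pM2l// ltW.
      have := u_pde s (x_ k) sT; rewrite -/v /K.
      move: h1 h2 h3; move: (k.+1%:R^-1) => c; lra.
    (* [K] has no known sign and may vanish, hence [|K| + 1]. *)
    have eK : 0 < e / 2 / (`|K| + 1) by rewrite !divr_gt0// ltr_wpDl.
    have [N1 N1P] := inv_small _ r0; have [N2 N2P] := inv_small _ eK.
    have e20 : 0 < e / 2 by rewrite divr_gt0.
    have [k] := aacc _ (maxn N1 N2) e20; rewrite geq_max => /andP[k1 k2].
    rewrite ltr_norml => /andP[ak _].
    have := vk k (N1P k k1).
    have : k.+1%:R^-1 * K <= e / 2.
      apply: le_trans (ler_norm _) _; rewrite normrM ger0_norm ?invr_ge0//.
      apply: le_trans (_ : e / 2 / (`|K| + 1) * (`|K| + 1) <= _).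
        by rewrite ler_pM ?invr_ge0// ?lerDl// ltW// N2P.
      by rewrite divfK// gt_eqF// ltr_wpDl.
    by move: (_ * K) => c; lra.
  have usup_ge : u x t <= usup u t.
    apply: (@le_sup_family _ _ u v x0 b (C b)) => //.
    - exact: ltW.
    - exact: u_b.
    - by move=> y q; apply: uv_b.
    - by move=> y q; apply: v_b.
    - by rewrite /= t0 ltW.
  apply: le_trans usup_ge _.
  have times' s : 0 <= s <= t -> times T' s.
    by move=> /andP[s0 st]; split=> //; rewrite (le_lt_trans _ tT')// lee_fin.
  have phi_approx s : 0 <= s <= t -> linear_approx (times T') phi s (F (phi s)).
    by move=> /times' sT'; apply/has_deriv_inP/phi_ode.
  apply: (@ode_comparison _ F (usup u) phi t) => //.
  - apply/within_continuous_itvP => s sI e e0.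
    have sb : 0 <= s <= b by lra.
    have C1_gt0 : 0 < C b + 1.
      by rewrite ltr_wpDl// (le_trans _ (v_b b x s b0 bT sb)).
    exists (e / (C b + 1)); first by rewrite divr_gt0.
    move=> r rI rs; have rb : 0 <= r <= b by lra.
    apply: le_lt_trans (usup_lip b r s b0 bT rb sb) _.
    apply: le_lt_trans (_ : (C b + 1) * `|r - s| < _).
      by rewrite ler_wpM2r// lerDl.
    by rewrite -ltr_pdivlMl// mulrC.
  - apply/within_continuous_itvP => s sI e e0.
    have /cvgrPdist_lt/(_ e e0)[d /= d0 dP] := linear_approx_cvg (phi_approx s sI).
    exists d => // r rI rs; rewrite distrC; apply: dP; last exact: times'.
    by rewrite /ball_/= distrC.
  - by rewrite phi0.
  (* The subgradient inequality at [s], read at an earlier time [r], bounds the left difference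
     quotient by [a + w b (s - r)], hence by [F (usup u s) + e]. *)
  - move=> s st e e0; have [a aslope aF] := slope_le s st.
    have [d d0 dP] := (w_mod b b0 bT).2 e e0.
    exists d => // r /andP[r0 rs] srd.
    have sr : 0 < s - r by rewrite subr_gt0.
    have := subgrad b r s a b0 bT _ _ aslope.
    rewrite distrC gtr0_norm// => /(_ _ _)/=.
    have wsr : w b (s - r) * (s - r) <= e * (s - r).
      by rewrite ler_pM2r// dP// ltW.
    have asr : a * (s - r) <= F (usup u s) * (s - r) by rewrite ler_pM2r.
    have rb : 0 <= r <= b by lra.
    have sb : 0 <= s <= b by lra.
    move=> /(_ rb sb); lra.
  - move=> s st e e0; have sI : 0 <= s <= t by lra.
    have [d d0 dP] := phi_approx s sI e e0.
    exists d => // r /andP[r0 rs] srd.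
    have sr : 0 < s - r by rewrite subr_gt0.
    have rI : 0 <= r <= t by lra.
    have := dP r (times' r rI); rewrite distrC gtr0_norm// => /(_ srd).
    rewrite ler_norml; lra.
Qed.
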